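(* Let $f\in\mathbb{R}[X]$ be a polynomial of even degree $d\geq 2$ with positive leading coefficient. Then $\mathrm{J}(f)\subseteq\mathbb{R}$ if and only if $f$ has at least one real fixed point and $[a_{1},a_{2}]\subseteq\mathrm{I}(f)$, where $a_{2}$ is the largest real fixed point of $f$ and $a_{1}$ is the smallest real root of $f(X)=a_{2}$.
   Context: $\mathrm{J}(f)\subseteq\mathbb{P}^1(\mathbb{C})$ is the Julia set of $f$, i.e. the complement of the maximal open subset of $\mathbb{P}^1(\mathbb{C})$ on which the family of iterates of $f$ is equicontinuous. For $f\in\mathbb{R}[X]$ of degree $d\ge2$, the critical interval $\mathrm{I}(f)$ is the set of all $t\in\mathbb{R}$ such that $f(X)=t$ has $d$ real solutions counted with multiplicity. *)

(* Defs.v *)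
From HB Require Import structures.
From mathcomp Require Import all_boot all_order all_algebra.
From mathcomp Require Import ring lra.
From mathcomp Require Import complex polyrcf.
From mathcomp Require Import all_classical all_reals.
From mathcomp Require Import all_analysis.

Set Implicit Arguments.
Unset Strict Implicit.
Unset Printing Implicit Defensive.

Import Order.TTheory GRing.Theory Num.Theory.
Import numFieldNormedType.Exports.

Local Open Scope classical_set_scope.
Local Open Scope ring_scope.
Local Open Scope complex_scope.

Local Notation normc := ComplexField.Normc.normc.

(* The complex projective line: [Some z] is the point [z : 1], and [None] is
   the point at infinity [1 : 0]. *)
Definition proj_line (R : realType) : Type := option R[i].

HB.instance Definition _ (R : realType) := Choice.on (proj_line R).
HB.instance Definition _ (R : realType) := Pointed.on (proj_line R).

Definition hcoord (R : realType) (x : proj_line R) : R[i] * R[i] :=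
  if x is Some z then (z, 1) else (1, 0).

Definition hnorm (R : realType) (p : R[i] * R[i]) : R :=
  Num.sqrt (normc p.1 ^+ 2 + normc p.2 ^+ 2).

Definition hdet (R : realType) (p q : R[i] * R[i]) : R[i] :=
  p.1 * q.2 - q.1 * p.2.

(* In affine coordinates this is
     |z - w| / (sqrt (1 + |z|^2) * sqrt (1 + |w|^2))   and
     1 / sqrt (1 + |z|^2)   for the distance from z to infinity. *)
Definition chordal (R : realType) (x y : proj_line R) : R :=
  normc (hdet (hcoord x) (hcoord y)) / (hnorm (hcoord x) * hnorm (hcoord y)).

Section chordal_metric.
Context {R : realType}.
Implicit Types (x y z : proj_line R) (p q r : R[i] * R[i]).

Let hprod p q : R[i] := p.1 * (q.1)^* + p.2 * (q.2)^*.

Let normc_sqr (c : R[i]) : normc c ^+ 2 = complex.Re c ^+ 2 + complex.Im c ^+ 2.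
Proof. by case: c => a b /=; rewrite sqr_sqrtr// addr_ge0// sqr_ge0. Qed.

Let normc0' : normc (0 : R[i]) = 0 :> R.
Proof. exact: ComplexField.Normc.normc0. Qed.

Let normc1' : normc (1 : R[i]) = 1 :> R.
Proof. exact: ComplexField.Normc.normc1. Qed.

Let normc_ge0 (c : R[i]) : 0 <= normc c.
Proof. by case: c => a b /=; exact: sqrtr_ge0. Qed.

Let hnorm_sqr p : hnorm p ^+ 2 = normc p.1 ^+ 2 + normc p.2 ^+ 2.
Proof. by rewrite sqr_sqrtr// addr_ge0// sqr_ge0. Qed.

Let hnorm_gt0 x : 0 < hnorm (hcoord x).
Proof.
rewrite sqrtr_gt0; case: x => [z|]; rewrite [hcoord _]/= [X in normc X]/=.
  by rewrite [X in _ + normc X ^+ 2]/= normc1' expr1n ltr_wpDl// sqr_ge0.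
by rewrite normc1' expr1n ltr_pwDl// sqr_ge0.
Qed.

Let hprod_le p r : normc (hprod p r) <= hnorm p * hnorm r.
Proof.
rewrite -(@ler_pXn2r _ 2)// ?nnegrE ?mulr_ge0 ?sqrtr_ge0// exprMn !hnorm_sqr.
have -> : (normc p.1 ^+ 2 + normc p.2 ^+ 2) * (normc r.1 ^+ 2 + normc r.2 ^+ 2)
    = normc (hprod p r) ^+ 2 + normc (hdet p r) ^+ 2.
  rewrite /hprod /hdet !normc_sqr; case: p r => [[a b] [c d]] [[e f] [g h]] /=.
  by ring.
by rewrite lerDl sqr_ge0.
Qed.

Let hdet_triangle p q r :
  normc (hdet p q) * hnorm r ^+ 2 <=
  normc (hdet p r) * (hnorm q * hnorm r) + normc (hdet r q) * (hnorm p * hnorm r).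
Proof.
have -> : normc (hdet p q) * hnorm r ^+ 2 =
    normc (hdet p r * hprod q r + hdet r q * hprod p r).
  have -> : hnorm r ^+ 2 = normc ((hnorm r ^+ 2)%:C).
    by rewrite /= expr0n/= addr0 sqrtr_sqr ger0_norm// sqr_ge0.
  rewrite -ComplexField.Normc.normcM; congr normc.
  rewrite hnorm_sqr !normc_sqr /hprod /hdet.
  case: p q r => [[a b] [c d]] [[a' b'] [c' d']] [[e f] [g h]] /=.
  by apply/eqP; rewrite eq_complex /=; apply/andP; split; apply/eqP; ring.
apply: (le_trans (@le_normcD R _ _)); rewrite !ComplexField.Normc.normcM.
by apply: lerD; apply: ler_wpM2l.
Qed.

Let chordalxx x : chordal x x = 0.
Proof. by rewrite /chordal /hdet subrr normc0' mul0r. Qed.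

Let chordal_positivity x y : chordal x y = 0 -> x = y.
Proof.
move/eqP; rewrite mulf_eq0 invr_eq0 [in X in _ || X]gt_eqF ?mulr_gt0// orbF.
move=> /eqP.
move/ComplexField.Normc.eq0_normc/eqP; rewrite /hdet.
case: x y => [z|] [w|] //; rewrite [hcoord _]/= ![hcoord _]/= [_.1]/= ![_.2]/=.
- by rewrite !mulr1 subr_eq0 => /eqP ->.
- by rewrite mulr0 mulr1 sub0r oppr_eq0 oner_eq0.
by rewrite !mulr1 mulr0 subr0 oner_eq0.
Qed.

Let chordal_sym x y : chordal x y = chordal y x.
Proof.
rewrite /chordal [hnorm _ * _]mulrC; congr (_ / _).
by rewrite -[RHS](@normcN R); congr normc; rewrite /hdet /= opprB mulrC [X in _ - X]mulrC.
Qed.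

Let chordal_triangle y x z : chordal x z <= chordal x y + chordal y z.
Proof.
have := hdet_triangle (hcoord x) (hcoord z) (hcoord y).
rewrite /chordal; move: (hnorm_gt0 x) (hnorm_gt0 y) (hnorm_gt0 z).
set a := hnorm (hcoord x); set b := hnorm (hcoord y); set c := hnorm (hcoord z).
move=> a0 b0 c0 H; rewrite ler_pdivrMr ?mulr_gt0//.
rewrite -(@ler_pM2r _ (b ^+ 2)) ?exprn_gt0//; apply: (le_trans H).
rewrite le_eqVlt; apply/orP; left; apply/eqP; field.
by rewrite !gt_eqF.
Qed.

HB.instance Definition _ := @isMetric.Build R (proj_line R)
  (@chordal R) chordalxx chordal_positivity chordal_sym chordal_triangle.

End chordal_metric.

Definition poly_map (R : realType) (p : {poly R[i]}) (x : proj_line R) :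
    proj_line R :=
  match x with
  | Some z => Some p.[z]
  | None => if (size p <= 1)%N then Some p`_0 else None
  end.

Definition fatou_set (R : realType) (g : proj_line R -> proj_line R) :
    set (proj_line R) :=
  \bigcup_(U in [set U | open U /\
                   {in U, equicontinuous [set: nat] (fun n => iter n g)}]) U.

Lemma fatou_maximal (R : realType) (g : proj_line R -> proj_line R) :
  [/\ open (fatou_set g),
      {in fatou_set g, equicontinuous [set: nat] (fun n => iter n g)}
    & forall U, open U ->
        {in U, equicontinuous [set: nat] (fun n => iter n g)} ->
        U `<=` fatou_set g].
Proof.
split; first by apply: bigcup_open => U [].
  by move=> x /set_mem[U [_ Ueq] Ux]; apply: Ueq; exact: mem_set.
by move=> U Uo Ueq x Ux; exists U.
Qed.

Definition julia_set (R : realType) (g : proj_line R -> proj_line R) :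
    set (proj_line R) := ~` fatou_set g.

Definition poly_julia_set (R : realType) (f : {poly R}) : set (proj_line R) :=
  julia_set (poly_map (map_poly (real_complex R) f)).

Definition real_points (R : realType) : set (proj_line R) :=
  [set Some (t%:C) | t in [set: R]].
Arguments real_points R : clear implicits.

Definition critical_interval (R : realType) (f : {poly R}) : set R :=
  [set t | (\sum_(x <- rootsR (f - t%:P)) mup x (f - t%:P) = (size f).-1)%N].

(* Main.v *)
(* Real-rootedness controls vertical growth: if all roots of q are real, then
   |q(x + iy)| / |q(x)| is the product over the roots r of
   sqrt(1 + y^2 / (x - r)^2).

   If f maps no point outside K = [a1, a2] into K, every root of f^n - t with
   t = a1 or t = a2 lies in K, and the degree of f^n tends to infinity; as
   |f^n(x) - t| >= (a2 - a1) / 2 for one of the two t, the orbit of every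
   nonreal x + iy is unbounded, so x + iy lies in the basin of infinity, which
   is contained in the Fatou set.  This replaces Montel's theorem.

   Conversely, boundedness of the orbit is an open and closed condition on the
   Fatou set, and it fails far away on a vertical ray; hence if the Julia set is
   real, all bounded orbits are.  The orbits of a1 and a2 and of their preimages
   are bounded, so a1 and a2 lie in I(f).  Finally I(f) is convex: a nonreal
   x + iy with f(x + iy) = u and s < u < t would satisfy
   |f(x) - s| < u - s and |f(x) - t| < t - u. *)
Require Import Defs.
From mathcomp Require Import all_boot all_order all_algebra.
From mathcomp Require Import ring lra complex polyrcf.
From mathcomp Require Import all_classical all_reals.
From mathcomp Require Import all_analysis.

Set Implicit Arguments.
Unset Strict Implicit.
Unset Printing Implicit Defensive.

Import Order.TTheory GRing.Theory Num.Theory.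
Import numFieldNormedType.Exports.

Local Open Scope classical_set_scope.
Local Open Scope ring_scope.

Local Notation normc := ComplexField.Normc.normc.
Local Notation Re := complex.Re.
Local Notation Im := complex.Im.
Local Notation cx := (map_poly (real_complex _)).

(** * Real-rooted polynomials *)

Section real_rooted_polynomials.
Context {R : realType}.
Implicit Types (p q : {poly R}) (z w : R[i]).

Definition real_rooted p := forall z, root (cx p) z -> Im z = 0.

Lemma Im0_real z : Im z = 0 -> z = (Re z)%:C%C.
Proof. by case: z => a b /= ->. Qed.

Lemma horner_cx p (x : R) : (cx p).[x%:C%C] = (p.[x])%:C%C.
Proof. exact: horner_map. Qed.

Lemma mup_cx p (x : R) : p != 0 -> mup x%:C%C (cx p) = mup x p.
Proof.
move=> p0; have cp0 : cx p != 0 by rewrite map_poly_eq0.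
have E n : (n <= mup x%:C%C (cx p))%N = (n <= mup x p)%N.
  rewrite !mup_geq// -(dvdp_map (real_complex R)) rmorphXn/= rmorphB/=.
  by rewrite map_polyX map_polyC.
by apply/eqP; rewrite eqn_leq E leqnn -E leqnn.
Qed.

Lemma mup_prod_XsubC (F : fieldType) (c : F) (r : seq F) (x : F) : c != 0 ->
  mup x (c *: \prod_(z <- r) ('X - z%:P)) = count_mem x r.
Proof.
move=> c0; rewrite -mul_polyC mupMr ?rootC//.
elim: r => [|z r IH]; first by rewrite big_nil mupNroot// root1.
rewrite big_cons mupM ?polyXsubC_eq0//; last first.
  by rewrite prodf_seq_neq0; apply/allP => w _; rewrite polyXsubC_eq0.
by rewrite IH/= -[X in mup x X]expr1 mup_XsubCX eq_sym; case: (_ == _).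
Qed.

(** Over the complex numbers [p] splits along a list [r] of roots, in which a real x occurs
    [mup x p] times. The sum thus counts the real entries of [r] and reaches the degree exactly when
    no entry is nonreal. *)
Lemma sum_mup_rootsR p : p != 0 ->
  (\sum_(x <- rootsR p) mup x p = (size p).-1)%N <-> real_rooted p.
Proof.
move=> p0; have cp0 : cx p != 0 by rewrite map_poly_eq0.
have [r cpE] := closed_field_poly_normal (cx p).
have lc0 : lead_coef (cx p) != 0 by rewrite lead_coef_eq0.
have rootE z : root (cx p) z = (z \in r).
  by rewrite cpE rootZ// root_prod_XsubC.
have szE : (size p).-1 = size r.
  rewrite -(size_map_poly (real_complex R) p) cpE size_scale//.
  by rewrite size_prod_XsubC.
have rootsRE (x : R) : (x \in rootsR p) = (x%:C%C \in r).
  have := roots_on_rootsR p0 x; rewrite in_itv/= => <-.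
  by rewrite -rootE fmorph_root.
have sumE : (\sum_(x <- rootsR p) mup x p = count (fun z => Im z == 0%R) r)%N.
  rewrite (eq_bigr (fun x => count_mem x%:C%C r)) => [|x _]; last first.
    by rewrite -mup_cx// cpE mup_prod_XsubC.
  have U : uniq (map (real_complex R) (rootsR p)).
    by rewrite map_inj_uniq ?uniq_roots//; exact: fmorph_inj.
  rewrite -(big_map (real_complex R) xpredT (fun z => count_mem z r)).
  rewrite -(eq_in_count (a1 := mem (map (real_complex R) (rootsR p)))).
    elim: (map _ _) U => [|z s IH] /=.
      by rewrite big_nil count_pred0.
    case/andP=> zs us; rewrite big_cons IH// -count_predUI.
    rewrite [X in (_ + X)%N](_ : _ = 0%N) ?addn0.
      by apply: eq_count => w /=; rewrite !inE.
    apply/eqP; rewrite -leqn0 leqNgt -has_count; apply/hasPn => w _ /=.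
    by apply/negP => /andP[/eqP ->]; apply/negP.
  move=> z zr /=; apply/mapP/eqP => [[x _ ->]//|/Im0_real zE].
  by exists (Re z) => //; rewrite rootsRE -zE.
rewrite sumE szE; split => [/eqP|H].
  by rewrite -all_count => /allP H z; rewrite rootE => /H/eqP.
by apply/eqP; rewrite -all_count; apply/allP => z; rewrite -rootE => /H ->.
Qed.

End real_rooted_polynomials.

Section modulus.
Context {R : realType}.
Implicit Types (z w : R[i]).

Lemma normc_ge0 z : 0 <= normc z.
Proof. by case: z => a b; exact: sqrtr_ge0. Qed.

Lemma normc_sqr z : normc z ^+ 2 = Re z ^+ 2 + Im z ^+ 2.
Proof. by case: z => a b /=; rewrite sqr_sqrtr// addr_ge0 ?sqr_ge0. Qed.

Lemma normc_real (x : R) : normc x%:C%C = `|x|.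
Proof. by rewrite /= expr0n/= addr0 sqrtr_sqr. Qed.

Lemma ler_normcD z w : normc (z + w) <= normc z + normc w.
Proof. exact: le_normcD. Qed.

Lemma normcB z w : normc (z - w) = normc (w - z).
Proof. by rewrite -opprB normcN. Qed.

Lemma ler_normcB z w : normc z - normc w <= normc (z - w).
Proof. by rewrite lerBlDr -{1}(subrK w z) ler_normcD. Qed.

End modulus.

(** * Growth of real-rooted polynomials along vertical lines *)

Section vertical_growth.
Context {R : realType}.
Implicit Types (p : {poly R[i]}) (z w : R[i]).

(** For a real root w, |z - w|^2 = (Re z - w)^2 + (Im z)^2 is at least (1 + eta)(Re z - w)^2;
    multiply over the roots. The division-free condition on [eta] admits roots equal to [Re z]. *)
Lemma real_roots_vertical_growth p z (eta : R) :
  (forall w, root p w -> Im w = 0) -> p != 0 -> 0 <= eta ->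
  (forall w, root p w -> eta * (Re z - Re w) ^+ 2 <= Im z ^+ 2) ->
  (1 + eta) ^+ (size p).-1 * normc p.[(Re z)%:C%C] ^+ 2 <= normc p.[z] ^+ 2.
Proof.
have [r pE] := closed_field_poly_normal p.
set c := lead_coef p in pE *; move=> Hr p0 eta0 Hz.
have c0 : c != 0 by rewrite lead_coef_eq0.
have rootE w : root p w = (w \in r) by rewrite pE rootZ// root_prod_XsubC.
have {Hr}Hr w : w \in r -> Im w = 0 by rewrite -rootE; exact: Hr.
have {Hz}Hz w : w \in r -> eta * (Re z - Re w) ^+ 2 <= Im z ^+ 2.
  by rewrite -rootE; exact: Hz.
have -> : (size p).-1 = size r.
  by rewrite pE size_scale// size_prod_XsubC.
rewrite pE !hornerZ !ComplexField.Normc.normcM !exprMn mulrCA.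
apply: ler_wpM2l; first exact: sqr_ge0.
rewrite !horner_prod.
elim: r Hr Hz {pE rootE} => [|w r IH] Hr Hz.
  by rewrite !big_nil expr0 mul1r.
rewrite !big_cons /= !ComplexField.Normc.normcM !exprMn exprS mulrACA.
apply: ler_pM; rewrite ?mulr_ge0 ?exprn_ge0 ?normc_ge0 ?addr_ge0//; last first.
  by apply: IH => u ur; [apply: Hr|apply: Hz]; rewrite in_cons ur orbT.
rewrite !hornerXsubC !normc_sqr.
have := Hz w (mem_head _ _); have := Hr w (mem_head _ _).
case: (w) (z) => [a b] [x y] /= ->; lra.
Qed.

Lemma real_roots_vertical_growth_strict p z :
  (forall w, root p w -> Im w = 0) -> (1 < size p)%N -> Im z != 0 ->
  ~~ root p (Re z)%:C%C -> normc p.[(Re z)%:C%C] < normc p.[z].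
Proof.
move=> Hr sp Imz nr.
have p0 : p != 0 by rewrite -size_poly_gt0 ltnW.
have [r pE] := closed_field_poly_normal p.
have rootE w : root p w = (w \in r).
  by rewrite pE rootZ ?lead_coef_eq0// root_prod_XsubC.
have y0 : 0 < Im z ^+ 2 by rewrite exprn_even_gt0.
have [eta eta0 Heta] : exists2 eta : R, 0 < eta &
    forall w, w \in r -> eta * (Re z - Re w) ^+ 2 <= Im z ^+ 2.
  elim: (r) => [|w s [eta eta0 IH]]; first by exists 1.
  (* The 1 in the denominator keeps [k] positive even when [Re w = Re z]. *)
  pose k := Im z ^+ 2 / (1 + (Re z - Re w) ^+ 2).
  have d0 : 0 < 1 + (Re z - Re w) ^+ 2 by rewrite ltr_pwDl// sqr_ge0.
  have k0 : 0 < k by rewrite divr_gt0.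
  exists (Num.min eta k); first by rewrite lt_min eta0.
  move=> u; rewrite in_cons => /orP[/eqP ->|us].
    have kE : k * (1 + (Re z - Re w) ^+ 2) = Im z ^+ 2.
      by rewrite divfK// gt_eqF.
    have : Num.min eta k <= k by rewrite ge_min lexx orbT.
    move/(ler_wpM2r (sqr_ge0 (Re z - Re w))); move: kE k0; lra.
  apply: le_trans (IH u us); apply: ler_wpM2r; first exact: sqr_ge0.
  by rewrite ge_min lexx.
rewrite -(ltr_pXn2r (n := 2))// ?nnegrE ?normc_ge0//.
have Heta' w : root p w -> eta * (Re z - Re w) ^+ 2 <= Im z ^+ 2.
  by rewrite rootE; exact: Heta.
apply: (lt_le_trans _ (real_roots_vertical_growth Hr p0 (ltW eta0) Heta')).
rewrite ltr_pMl; last first.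
  rewrite exprn_gt0// lt_neqAle normc_ge0 andbT eq_sym; apply/eqP.
  by move/ComplexField.Normc.eq0_normc/eqP; apply/negP.
by rewrite exprn_egt1 ?ltrDl// -lt0n; case: (size p) sp => [|[]].
Qed.

End vertical_growth.

Lemma real_rooted_convex (R : realType) (f : {poly R}) (s t u : R) :
  (2 < size f)%N -> s <= u <= t ->
  real_rooted (f - s%:P) -> real_rooted (f - t%:P) -> real_rooted (f - u%:P).
Proof.
move=> sf /andP[su ut] rs rt z rz; apply/eqP; apply: contraT => Imz.
have sizeB c : size (f - c%:P) = size f.
  by rewrite size_polyDl// size_polyN (leq_ltn_trans (size_polyC_leq1 c))// ltnW.
have fz : (cx f).[z] = u%:C%C.
  move: rz; rewrite rmorphB/= map_polyC rootE hornerD hornerN hornerC subr_eq0.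
  by move/eqP.
have E c : (cx (f - c%:P)).[z] = (u - c)%:C%C.
  by rewrite rmorphB/= map_polyC hornerD hornerN hornerC fz -rmorphB.
have key c : real_rooted (f - c%:P) ->
    `|f.[Re z] - c| < `|u - c| \/ `|f.[Re z] - c| = 0.
  move=> rc; case: (boolP (root (cx (f - c%:P)) (Re z)%:C%C)).
    rewrite fmorph_root rootE hornerD hornerN hornerC => /eqP ->.
    by rewrite normr0; right.
  move=> nr; left; rewrite -!normc_real -E.
  have -> : ((f.[Re z] - c)%:C)%C = (cx (f - c%:P)).[(Re z)%:C%C].
    by rewrite horner_cx hornerD hornerN hornerC.
  apply: real_roots_vertical_growth_strict => //.
  by rewrite size_map_poly sizeB ltnW.
(* As |f(x) - s| + |f(x) - t| >= (u - s) + (t - u), where x is [Re z], a single strict inequality is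
   already contradictory. If both distances vanish, then s = t = u and z is a root of f - s. *)
have [Hs|/normr0P/eqP Hs] := key s rs; have [Ht|/normr0P/eqP Ht] := key t rt.
- move: Hs Ht; rewrite (ger0_norm (x := u - s)) ?subr_ge0//.
  rewrite (ler0_norm (x := u - t)) ?subr_le0// => Hs Ht.
  have := ler_norm (f.[Re z] - s); have := ler_norm (- (f.[Re z] - t)).
  by rewrite normrN; lra.
- by move: Hs; rewrite !ger0_norm ?subr_ge0//; lra.
- by move: Ht; rewrite !ler0_norm ?subr_le0//; lra.
have us : u = s by lra.
by move: rz; rewrite us => /rs/eqP; rewrite (negPf Imz).
Qed.

(** * Growth of polynomials and the chordal topology *)

Section polynomial_estimates.
Context {R : realType}.
Implicit Types (p : {poly R[i]}) (z w : R[i]).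

(** Horner induction: where |z| >= 1 and |p(z)| >= L, |z p(z) + c| >= L|z| - |c|. If the inner p is
    nonconstant, L can be made large; if it is a nonzero constant, |z| is made large instead. *)
Lemma poly_normc_pinfty p (A : R) : (1 < size p)%N ->
  exists M, forall z, M <= normc z -> A <= normc p.[z].
Proof.
elim/poly_ind: p A => [|p c IH] A; first by rewrite size_poly0.
rewrite size_MXaddC; case: ifP => // /negbT pc0 /=.
rewrite ltnS => sp.
have bound (L : R) z : 1 <= normc z -> L <= normc p.[z] ->
    L * normc z - normc c <= normc (p * 'X + c%:P).[z].
  move=> z1 Lz; rewrite hornerMXaddC.
  apply: (@le_trans _ _ (normc (p.[z] * z) - normc c)).
    by rewrite lerB// ComplexField.Normc.normcM ler_wpM2r// (le_trans ler01).
  by have := ler_normcB (p.[z] * z) (- c); rewrite normcN opprK.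
have c0 := normc_ge0 c.
have [sp1|sp1] := leqP (size p) 1; last first.
  have [M HM] := IH (`|A| + normc c) sp1.
  exists (Num.max M 1) => z; rewrite ge_max => /andP[Mz z1].
  apply: le_trans (bound _ z z1 (HM z Mz)).
  have := ler_norm A; have := normr_ge0 A; nra.
have p0 : 0 < normc p`_0.
  rewrite lt_neqAle normc_ge0 andbT; apply/eqP => /esym/ComplexField.Normc.eq0_normc p0.
  by move: sp; rewrite (size1_polyC sp1) p0 polyC0 size_poly0.
exists (Num.max 1 ((`|A| + normc c) / normc p`_0)) => z.
rewrite ge_max ler_pdivrMr// => /andP[z1 Hz].
have pz : normc p`_0 <= normc p.[z] by rewrite (size1_polyC sp1) hornerC coefC.
apply: le_trans (bound _ z z1 pz).
by have := ler_norm A; lra.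
Qed.

(** Supplies the escape radius: writing the polynomial as qX + c with q nonconstant, |q(z)| >= 3 far
    out, and the surplus |z| absorbs |c|. *)
Lemma poly_normc_double p : (2 < size p)%N ->
  exists2 M : R, 0 < M & forall z, M <= normc z -> 2 * normc z <= normc p.[z].
Proof.
elim/poly_ind: p => [|p c _]; first by rewrite size_poly0.
rewrite size_MXaddC; case: ifP => // _; rewrite ltnS => sp.
have [M HM] := poly_normc_pinfty 3 sp.
exists (Num.max M (1 + normc c)).
  by rewrite lt_max orbC ltr_pwDl// normc_ge0.
move=> z; rewrite ge_max => /andP[/HM pz cz]; rewrite hornerMXaddC.
have := ler_normcB (p.[z] * z) (- c); rewrite normcN opprK.
rewrite ComplexField.Normc.normcM.
have := normc_ge0 c; have := normc_ge0 z; nra.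
Qed.

Lemma poly_locally_lipschitz p z : exists2 C : R, 0 <= C &
  forall w, normc (w - z) <= 1 -> normc (p.[w] - p.[z]) <= C * normc (w - z).
Proof.
elim/poly_ind: p => [|p c [C C0 HC]].
  exists 0 => // w _; rewrite !horner0 subrr mul0r.
  by rewrite ComplexField.Normc.normc0.
exists (C * (normc z + 1) + normc p.[z]).
  by rewrite addr_ge0 ?mulr_ge0 ?addr_ge0 ?normc_ge0.
move=> w wz; rewrite !hornerMXaddC.
have -> : p.[w] * w + c - (p.[z] * z + c) =
    (p.[w] - p.[z]) * w + p.[z] * (w - z) by ring.
apply: (le_trans (ler_normcD _ _)); rewrite !ComplexField.Normc.normcM mulrDl.
rewrite lerD2r mulrAC; apply: ler_pM; rewrite ?normc_ge0 ?HC//.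
by have := ler_normcB w z; lra.
Qed.

End polynomial_estimates.

(** * Chordal neighbourhoods in affine coordinates *)

Section chordal_topology.
Context {R : realType}.
Implicit Types (x y : proj_line R) (z w : R[i]) (A : set (proj_line R)).

Lemma ball_chordalE x (e : R) y : ball x e y = (chordal x y < e) :> Prop.
Proof. by rewrite ballEmdist. Qed.

Lemma hnorm_Some_bounds z : [/\ 1 <= hnorm (hcoord (Some z)),
  normc z <= hnorm (hcoord (Some z)) & hnorm (hcoord (Some z)) <= 1 + normc z].
Proof.
have z0 := normc_ge0 z.
have h0 : 0 <= hnorm (hcoord (Some z)) by exact: sqrtr_ge0.
have hE : hnorm (hcoord (Some z)) ^+ 2 = 1 + normc z ^+ 2.
  rewrite /hnorm sqr_sqrtr ?addr_ge0 ?sqr_ge0//.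
  by rewrite [_.1]/= [_.2]/= ComplexField.Normc.normc1 expr1n addrC.
by split; rewrite -(@ler_pXn2r _ 2)// ?nnegrE ?addr_ge0// hE; nra.
Qed.

Lemma hnorm_None : hnorm (hcoord (None : proj_line R)) = 1.
Proof.
rewrite /hnorm [_.1]/= [_.2]/= ComplexField.Normc.normc1.
by rewrite ComplexField.Normc.normc0 expr0n expr1n addr0 sqrtr1.
Qed.

Lemma chordal_SomeE z w : normc (z - w) = chordal (Some z) (Some w) *
  (hnorm (hcoord (Some z)) * hnorm (hcoord (Some w))).
Proof.
have [z1 _ _] := hnorm_Some_bounds z; have [w1 _ _] := hnorm_Some_bounds w.
rewrite /chordal divfK; first by rewrite /hdet [_.1]/= [_.2]/= !mulr1.
by rewrite mulf_neq0// gt_eqF// (lt_le_trans ltr01).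
Qed.

Lemma chordal_NoneE w : chordal None (Some w) * hnorm (hcoord (Some w)) = 1.
Proof.
have [w1 _ _] := hnorm_Some_bounds w.
rewrite /chordal hnorm_None mul1r divfK ?gt_eqF ?(lt_le_trans ltr01)//.
by rewrite /hdet [_.1]/= [_.2]/= mulr1 mulr0 subr0 ComplexField.Normc.normc1.
Qed.

Lemma chordal_ge0 x y : 0 <= chordal x y.
Proof. by rewrite divr_ge0 ?mulr_ge0 ?sqrtr_ge0 ?normc_ge0. Qed.

Lemma chordal_sym x y : chordal x y = chordal y x.
Proof. exact: (@metric_sym _ (proj_line R)). Qed.

Lemma chordal_triangle y x x' : chordal x x' <= chordal x y + chordal y x'.
Proof. exact: (@metric_triangle _ (proj_line R)). Qed.

Lemma chordal_le_normc z w : chordal (Some z) (Some w) <= normc (z - w).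
Proof.
rewrite chordal_SomeE ler_peMr ?chordal_ge0//.
have [z1 _ _] := hnorm_Some_bounds z; have [w1 _ _] := hnorm_Some_bounds w.
nra.
Qed.

(** Local converse of [chordal_le_normc]. With e the chordal distance, m = 1 + |z| and d = |z - w|,
    one has d <= e m (m + d); as e m <= 1/2, the term e m d is absorbed on the left. *)
Lemma normc_le_chordal z w : chordal (Some z) (Some w) * (1 + normc z) <= 2^-1 ->
  normc (z - w) <= 2 * chordal (Some z) (Some w) * (1 + normc z) ^+ 2.
Proof.
have [z1 _ zu] := hnorm_Some_bounds z; have [w1 _ wu] := hnorm_Some_bounds w.
have e0 := chordal_ge0 (Some z) (Some w); have n0 := normc_ge0 z.
have wz : normc w <= normc z + normc (z - w).
  by have := ler_normcB w z; rewrite normcB; lra.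
move=> eh; have := chordal_SomeE z w; set e := chordal _ _ in e0 eh *.
set hz := hnorm _ in z1 zu *; set hw := hnorm _ in w1 wu *.
move: wz; set d := normc (z - w); set m := 1 + normc z in eh zu * => wz dE.
have d0 : 0 <= d by exact: normc_ge0.
have H1 : d <= e * (m * (m + d)).
  by rewrite {1}dE ler_wpM2l// ler_pM//; rewrite /m; lra.
have H2 : e * m * d <= 2^-1 * d by exact: ler_wpM2r.
by move: H1 H2; rewrite expr2; lra.
Qed.

Lemma chordal_None_le w : normc w * chordal None (Some w) <= 1.
Proof.
rewrite -(chordal_NoneE w) mulrC; apply: ler_wpM2l; first exact: chordal_ge0.
by have [] := hnorm_Some_bounds w.
Qed.

Lemma chordal_None_ge w : 1 <= (1 + normc w) * chordal None (Some w).
Proof.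
rewrite -{1}(chordal_NoneE w) mulrC; apply: ler_wpM2r; first exact: chordal_ge0.
by have [] := hnorm_Some_bounds w.
Qed.

Lemma nbhs_Some z A : nbhs (Some z : proj_line R) A <->
  exists2 d : R, 0 < d & forall w, normc (w - z) < d -> A (Some w).
Proof.
have n0 := normc_ge0 z.
split => [/nbhs_ballP[e /= e0 He]|[d d0 Hd]].
  exists e => // w wz; apply: He; rewrite ball_chordalE.
  by apply: le_lt_trans (chordal_le_normc _ _) _; rewrite normcB.
apply/nbhs_ballP; pose m := 1 + normc z.
have m0 : 0 < m by rewrite /m; lra.
(* The first bound keeps infinity out of the ball and permits [normc_le_chordal]; the second turns
   its conclusion into |w - z| < d. *)
pose e := Num.min ((2 * m)^-1) (d / (2 * m ^+ 2)).
exists e => /=.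
  by rewrite lt_min invr_gt0 divr_gt0 ?mulr_gt0 ?exprn_gt0.
move=> y; rewrite ball_chordalE lt_min => /andP[].
rewrite ltr_pdivlMr ?mulr_gt0 ?exprn_gt0// -[X in _ < X]div1r ltr_pdivlMr ?mulr_gt0//.
case: y => [w|] H1 H2.
  apply: Hd; rewrite normcB.
  apply: (@le_lt_trans _ _ (2 * chordal (Some z) (Some w) * m ^+ 2)).
    by apply: normc_le_chordal; rewrite -/m; move: H1; lra.
  by move: H2; lra.
exfalso; move: H1; have := chordal_None_ge z; rewrite chordal_sym -/m; lra.
Qed.

Lemma nbhs_None A : nbhs (None : proj_line R) A <->
  A None /\ exists M : R, forall w, M <= normc w -> A (Some w).
Proof.
split => [nA|[A0 [M HM]]].
  split; first exact: (nbhs_singleton nA).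
  have /nbhs_ballP[e /= e0 He] := nA.
  exists (2 / e) => w; rewrite ler_pdivrMr// => ew; apply: He.
  rewrite ball_chordalE; have := chordal_None_le w.
  have := chordal_ge0 None (Some w); have := normc_ge0 w; nra.
(* A point with |w| < M is at chordal distance at least 1 / (1 + |w|) > 1 / (2 + |M|) from
   infinity. *)
apply/nbhs_ballP; exists (2 + `|M|)^-1 => /=.
  by rewrite invr_gt0; have := normr_ge0 M; lra.
case=> [w|//]; rewrite ball_chordalE -[X in _ < X]div1r ltr_pdivlMr; last first.
  by have := normr_ge0 M; lra.
move=> H; apply: HM; rewrite leNgt; apply/negP => wM.
have := chordal_None_ge w; have := chordal_ge0 None (Some w).
have := ler_norm M; have := normc_ge0 w; nra.
Qed.

End chordal_topology.

(** * Bounded orbits and the Fatou set *)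

Section polynomial_dynamics.
Context {R : realType} (p : {poly R[i]}) (sp : (2 < size p)%N).
Implicit Types (x y : proj_line R) (z w : R[i]).

Local Notation orbit n z := (iter n (horner p) z).

Definition bounded_orbit z := exists B : R, forall n, normc (orbit n z) <= B.

Lemma poly_map_None : poly_map p None = None.
Proof. by rewrite /poly_map leqNgt (ltnW sp). Qed.

Lemma iter_poly_map_None n : iter n (poly_map p) None = None.
Proof. by elim: n => //= n ->; exact: poly_map_None. Qed.

Lemma iter_poly_map_Some n z : iter n (poly_map p) (Some z) = Some (orbit n z).
Proof. by elim: n => //= n ->. Qed.

Lemma poly_map_continuous : continuous (poly_map p).
Proof.
case=> [z|] A.
  rewrite /= => /nbhs_Some[d d0 Hd]; apply/nbhs_Some.
  have [C C0 HC] := poly_locally_lipschitz p z.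
  exists (Num.min 1 (d / (C + 1))).
    by rewrite lt_min ltr01 divr_gt0// ltr_wpDl.
  move=> w; rewrite lt_min ltr_pdivlMr ?ltr_wpDl// => /andP[w1 wd].
  apply: Hd; apply: (le_lt_trans (HC w (ltW w1))); apply: le_lt_trans wd.
  by rewrite mulrC ler_wpM2l ?normc_ge0// lerDl.
rewrite [poly_map p None]poly_map_None => /nbhs_None[A0 [M HM]].
apply/nbhs_None; split; first by rewrite /= leqNgt (ltnW sp).
have [N HN] := poly_normc_pinfty M (ltnW sp).
by exists N => w /HN/HM.
Qed.

Lemma iter_poly_map_continuous n : continuous (iter n (poly_map p)).
Proof.
elim: n => [|n IH] x; first exact: cvg_id.
by apply: (@continuous_comp _ _ _ (iter n (poly_map p)) (poly_map p));
  [exact: IH|exact: poly_map_continuous].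
Qed.

Lemma iter_poly_map_nbhs n x A : nbhs (iter n (poly_map p) x) A ->
  nbhs x [set y | A (iter n (poly_map p) y)].
Proof. exact: iter_poly_map_continuous. Qed.

Lemma bounded_orbit_preimage z : bounded_orbit p.[z] -> bounded_orbit z.
Proof.
case=> B HB; exists (Num.max B (normc z)) => -[|n].
  by rewrite le_max lexx orbT.
by rewrite iterSr le_max HB.
Qed.

Lemma bounded_orbit_fixed z : p.[z] = z -> bounded_orbit z.
Proof. by move=> pz; exists (normc z) => n; rewrite iter_fix. Qed.

(** * Escape to infinity *)

Section escape.
Variables (M : R) (M0 : 0 < M).
Hypothesis HM : forall z, M <= normc z -> 2 * normc z <= normc p.[z].

Lemma escape_growth k z : M <= normc z -> k%:R * M <= normc (orbit k z).
Proof.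
(* The maximum with [M] keeps the orbit where [HM] applies; each doubling then adds at least [M]. *)
move=> Mz; suff: Num.max M (k%:R * M) <= normc (orbit k z).
  by rewrite ge_max => /andP[].
elim: k => [|k]; first by rewrite mul0r ge_max Mz normc_ge0.
rewrite /= !ge_max -(natr1 k) mulrDl mul1r => /andP[IH1 IH2]; have := HM IH1.
by have := normc_ge0 (orbit k z) => n0 H; apply/andP; split; lra.
Qed.

(** One visit outside the disc of radius [M] forces unbounded growth, so all bounded orbits share
    the bound [M], whatever their own [B]. *)
Lemma bounded_orbit_le z n : bounded_orbit z -> normc (orbit n z) <= M.
Proof.
case=> B HB; rewrite leNgt; apply/negP => /ltW Mz.
have B0 : 0 <= B by apply: le_trans (HB 0%N); exact: normc_ge0.
pose k := (Num.truncn (B / M)).+1.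
have := escape_growth k Mz; rewrite -iterD; have := HB (k + n)%N.
have : B < k%:R * M by rewrite -ltr_pdivrMr// truncnS_gt.
lra.
Qed.

Lemma unbounded_orbit_escape z : ~ bounded_orbit z -> exists n, M < normc (orbit n z).
Proof.
move=> nb; apply: contrapT => H; apply: nb; exists M => n.
by rewrite leNgt; apply/negP => Mn; apply: H; exists n.
Qed.

Let far : set (proj_line R) := [set x | if x is Some z then M < normc z else True].

Let far_open x : far x -> nbhs x far.
Proof.
case: x => [z|] /= Hz.
  apply/nbhs_Some; exists (normc z - M); first by rewrite subr_gt0.
  by move=> w wz /=; have := ler_normcB z w; rewrite normcB; lra.
by apply/nbhs_None; split=> //; exists (M + 1) => w; rewrite /far/=; lra.
Qed.

Let far_chordal k x : far x -> k%:R * M * chordal None (iter k (poly_map p) x) <= 1.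
Proof.
case: x => [z|] Hz.
  rewrite iter_poly_map_Some; apply: le_trans (chordal_None_le (orbit k z)).
  by apply: ler_wpM2r; [exact: chordal_ge0|exact/escape_growth/ltW].
rewrite iter_poly_map_None (_ : chordal _ _ = 0) ?mulr0//.
exact: (@mdistxx _ (proj_line R)).
Qed.

Let basin : set (proj_line R) := [set x | exists N, far (iter N (poly_map p) x)].

Let basin_open : open basin.
Proof.
rewrite openE => x [N /far_open/(@iter_poly_map_nbhs N) Nx].
by apply: filterS Nx => y Hy; exists N.
Qed.

(** Near x the N-th iterate is already in [far], so from time k + N on both orbits are within e/2 of
    infinity; the finitely many earlier iterates are handled by continuity. *)
Let basin_equicontinuous :
  {in basin, equicontinuous [set: nat] (fun n => iter n (poly_map p))}.
Proof.
move=> x /set_mem[N Nx] E.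
rewrite -entourage_ballE => -[e /= e0 He].
(* Chosen so that 1 / (k M) < e / 2. *)
pose k := (Num.truncn (2 / (e * M))).+1.
have kP : 2 < k%:R * (e * M) by rewrite -ltr_pdivrMr ?mulr_gt0// truncnS_gt.
have tail y n : far (iter N (poly_map p) y) -> (k + N <= n)%N ->
    chordal None (iter n (poly_map p) y) < e / 2.
  move=> Hy kn; have := far_chordal (n - N) Hy.
  rewrite -iterD subnK ?(leq_trans (leq_addl k N))//.
  set c := chordal _ _; have c0 : 0 <= c by exact: chordal_ge0.
  have kn' : k%:R <= (n - N)%:R :> R.
    by rewrite ler_nat leq_subRL ?(leq_trans (leq_addl k N))// addnC.
  rewrite ltr_pdivlMr// => H; rewrite ltNge; apply/negP => ec.
  have H1 : k%:R * M * c <= (n - N)%:R * M * c.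
    by rewrite -!mulrA ler_wpM2r// mulr_ge0// ltW.
  have : k%:R * M * e <= k%:R * M * (c * 2).
    by rewrite ler_wpM2l// mulr_ge0// ltW.
  by move: kP H H1; lra.
have head K : \forall y \near x, forall n, (n < K)%N ->
    E (iter n (poly_map p) x, iter n (poly_map p) y).
  elim: K => [|K IH]; first by near=> y.
  have HK : \forall y \near x, E (iter K (poly_map p) x, iter K (poly_map p) y).
    have : nbhs (iter K (poly_map p) x) (ball (iter K (poly_map p) x) e).
      by apply/nbhs_ballP; exists e.
    move/(@iter_poly_map_nbhs K) => HK.
    by apply: filterS HK => y Hy; apply: He.
  near=> y => n; rewrite ltnS leq_eqVlt => /orP[/eqP ->|].
    by near: y.
  by move: n; near: y.
have Fx := iter_poly_map_nbhs (far_open Nx).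
near=> y => n _; have [nK|Kn] := ltnP n (k + N).
  by move: n nK; near: y; exact: head.
apply: He; rewrite /= ball_chordalE.
apply: (le_lt_trans (chordal_triangle None _ _)).
rewrite [e]splitr ltrD// ?[chordal _ None]chordal_sym; first exact: tail.
by apply: tail => //; near: y.
Unshelve. all: by end_near. Qed.

Let basin_fatou : basin `<=` fatou_set (poly_map p).
Proof.
have [_ _ maxF] := fatou_maximal (poly_map p).
exact: maxF basin_open basin_equicontinuous.
Qed.

Lemma unbounded_orbit_fatou z : ~ bounded_orbit z -> fatou_set (poly_map p) (Some z).
Proof.
move=> /unbounded_orbit_escape[n zn]; apply: basin_fatou; exists n.
by rewrite iter_poly_map_Some.
Qed.

(** The basin of infinity is open, and by [bounded_orbit_le] it contains no bounded orbit. *)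
Lemma unbounded_orbit_near z : ~ bounded_orbit z ->
  exists2 d : R, 0 < d & forall w, normc (w - z) < d -> ~ bounded_orbit w.
Proof.
move=> /unbounded_orbit_escape[n zn].
have zb : basin (Some z) by exists n; rewrite iter_poly_map_Some.
have /nbhs_Some[d d0 Hd] := open_nbhs_nbhs (conj basin_open zb).
exists d => // w /Hd[k]; rewrite iter_poly_map_Some => wk /(bounded_orbit_le k).
by rewrite leNgt wk.
Qed.

Lemma infty_fatou : fatou_set (poly_map p) None.
Proof. by apply: basin_fatou; exists 0%N. Qed.

(** Equicontinuity gives one neighbourhood of z on which all iterates stay chordally close to the
    orbit of z. That orbit remains in the disc of radius [M], where chordal closeness controls the
    ordinary distance. *)
Lemma bounded_orbit_near z : fatou_set (poly_map p) (Some z) -> bounded_orbit z ->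
  exists2 d : R, 0 < d & forall w, normc (w - z) < d -> bounded_orbit w.
Proof.
move=> /mem_set Fz bz; have [_ /(_ _ Fz) eqz _] := fatou_maximal (poly_map p).
(* With this radius [normc_le_chordal] yields |u - v| <= 1 + |u| whenever |u| <= M, hence |v| <= 2M
   + 1 along the orbit of w. *)
pose e : R := (2 * (1 + M))^-1.
have e0 : 0 < e by rewrite invr_gt0 mulr_gt0// addr_gt0.
have /eqz/nbhs_Some[d d0 Hd] :
    entourage [set xy : proj_line R * proj_line R | ball xy.1 e xy.2].
  exact: entourage_ball (PosNum e0).
exists d => // w /Hd Hw; exists (M + M + 1 + 1) => n.
have /= := Hw n I; rewrite !iter_poly_map_Some ball_chordalE.
have := bounded_orbit_le n bz; set u := orbit n z; set v := orbit n w.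
move=> uM; rewrite /e -[X in _ < X]div1r ltr_pdivlMr ?mulr_gt0 ?addr_gt0// => uv.
have c0 := chordal_ge0 (Some u) (Some v).
have u0 := normc_ge0 u.
have H1 : chordal (Some u) (Some v) * (1 + normc u) <= 2^-1.
  apply: (@le_trans _ _ (chordal (Some u) (Some v) * (1 + M))).
    by rewrite ler_wpM2l// lerD2l.
  by move: uv; lra.
have := normc_le_chordal H1; have := ler_normcB v u; rewrite normcB.
move: H1; set c := chordal _ _; set m := normc u in uM u0 *.
move=> H1 H2 H3; have : 2 * c * (1 + m) ^+ 2 <= 1 + m.
  have -> : 2 * c * (1 + m) ^+ 2 = c * (1 + m) * (2 * (1 + m)) by ring.
  by apply: le_trans (ler_wpM2r _ H1) _; lra.
by move: H2 H3; lra.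
Qed.

End escape.

End polynomial_dynamics.

(** * Real polynomials *)

Section real_polynomial_dynamics.
Context {R : realType} (f : {poly R}).
Implicit Types (x t : R) (z w : R[i]).

Local Notation orbit n z := (iter n (horner (cx f)) z).

Let iterpoly n : {poly R[i]} := iter n (fun q => cx f \Po q) 'X.

Let horner_iterpoly n z : (iterpoly n).[z] = orbit n z.
Proof. by elim: n => [|n IH] /=; rewrite ?hornerX// horner_comp IH. Qed.

Let size_iterpoly n : (size (iterpoly n)).-1 = ((size f).-1 ^ n)%N.
Proof.
elim: n => [|n IH] /=; first by rewrite size_polyX.
by rewrite size_comp_poly IH size_map_poly expnS.
Qed.

Lemma ler_bernoulli (e : R) n : 0 <= e -> 1 + n%:R * e <= (1 + e) ^+ n.
Proof.
move=> e0; elim: n => [|n IH]; first by rewrite mul0r addr0.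
rewrite exprS; apply: (@le_trans _ _ ((1 + e) * (1 + n%:R * e))).
  rewrite -natr1 !mulrDl !mul1r mulrDr mulr1.
  have : 0 <= e * (n%:R * e) by rewrite !mulr_ge0.
  lra.
by rewrite ler_wpM2l// addr_ge0.
Qed.

Lemma nonreal_unbounded_orbit (a b : R) z : (2 < size f)%N -> a < b ->
  (forall t w, a <= t <= b -> (cx f).[w] = t%:C%C ->
     exists2 x, a <= x <= b & w = x%:C%C) ->
  Im z != 0 -> ~ bounded_orbit (cx f) z.
Proof.
move=> sf ab Hinv Imz [B HB].
have inv n t w : a <= t <= b -> orbit n w = t%:C%C ->
    exists2 x, a <= x <= b & w = x%:C%C.
  elim: n t => [|n IH] t tab; first by exists t.
  by rewrite iterS => /(Hinv _ _ tab)[u uab /(IH _ uab)].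
(* [D] dominates (x - r)^2 for every r in [a, b], so a single [eta] serves all n and all roots. *)
pose x := Re z; pose D := 1 + (x - a) ^+ 2 + (x - b) ^+ 2.
have D0 : 0 < D by rewrite /D; have := sqr_ge0 (x - a); have := sqr_ge0 (x - b); lra.
pose eta := Im z ^+ 2 / D.
have y0 : 0 < Im z ^+ 2 by rewrite exprn_even_gt0.
have eta0 : 0 < eta by rewrite divr_gt0.
have etaE : eta * D = Im z ^+ 2 by rewrite divfK// gt_eqF.
have B0 : 0 <= B by apply: le_trans (HB 0%N); exact: normc_ge0.
pose C := B + `|a| + `|b|.
(* Linear growth in n suffices for the contradiction; Bernoulli's inequality and d^n > n, with d the
   degree of f, provide it. [C] bounds |f^n(z) - t|. *)
have main n : n%:R * eta * ((b - a) / 2) ^+ 2 <= C ^+ 2.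
  set q := iterpoly n.
  have [t tE Ht] : exists2 t, (t = a) \/ (t = b) &
      (b - a) / 2 <= normc (q - t%:C%C%:P).[x%:C%C].
    have : b - a <= normc (q - a%:C%C%:P).[x%:C%C] + normc (q - b%:C%C%:P).[x%:C%C].
      rewrite [X in _ <= _ + X](_ : _ = normc (b%:C%C - q.[x%:C%C])); last first.
        by rewrite hornerD hornerN hornerC normcB.
      apply: le_trans (ler_normcD _ _); rewrite hornerD hornerN hornerC.
      rewrite [X in normc X](_ : _ = (b - a)%:C%C).
        by rewrite normc_real ler_norm.
      by rewrite rmorphB/=; ring.
    have [H _|H H'] := leP ((b - a) / 2) (normc (q - a%:C%C%:P).[x%:C%C]).
      by exists a; [left|].
    by exists b; [right|lra].
  have tab : a <= t <= b by case: tE => ->; rewrite lexx ltW.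
  have rootE w : root (q - t%:C%C%:P) w -> exists2 r, a <= r <= b & w = r%:C%C.
    rewrite /root hornerD hornerN hornerC subr_eq0 horner_iterpoly => /eqP.
    exact: inv.
  (* Makes the degree of f^n positive, also for n = 0, so that subtracting t does not change it. *)
  have d1 : (n < (size f).-1 ^ n)%N.
    by apply: ltn_expl; case: (size f) sf => [|[|[]]].
  have szq : size (q - t%:C%C%:P) = size q.
    rewrite size_polyDl// size_polyN (leq_ltn_trans (size_polyC_leq1 _))//.
    have := size_iterpoly n; rewrite -/q.
    by case: (size q) => [|[|k]] //= E; move: d1; rewrite -E.
  have q0 : q - t%:C%C%:P != 0.
    rewrite -size_poly_eq0 szq; apply/eqP => E; have := size_iterpoly n.
    by rewrite -/q E /= => E'; move: d1; rewrite -E'.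
  have G : (1 + eta) ^+ ((size f).-1 ^ n) * normc (q - t%:C%C%:P).[x%:C%C] ^+ 2
      <= normc (q - t%:C%C%:P).[z] ^+ 2.
    rewrite -size_iterpoly -szq.
    apply: real_roots_vertical_growth (q0) (ltW eta0) _.
      by move=> w /rootE[r _ ->].
    move=> w /rootE[r /andP[ar rb] ->]; rewrite -etaE ler_wpM2l ?(ltW eta0)//=.
    (* With A = r - a and B' = b - r, D - (x - r)^2 = 1 + (x - r + A - B')^2 + 2 A B'. *)
    rewrite -/x /D; have : 0 <= (r - a) * (b - r) by rewrite mulr_ge0 ?subr_ge0.
    by have := sqr_ge0 (x - r + (r - a) - (b - r)); rewrite !expr2; lra.
  apply: (@le_trans _ _ (normc (q - t%:C%C%:P).[z] ^+ 2)); last first.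
    rewrite ler_pXn2r ?nnegrE ?normc_ge0 ?addr_ge0//.
    rewrite hornerD hornerN hornerC horner_iterpoly.
    apply: (le_trans (ler_normcD _ _)); rewrite normcN normc_real /C -addrA.
    apply: lerD; first exact: HB.
    by case: tE => ->; rewrite ?lerDl ?lerDr.
  apply: le_trans G; apply: ler_pM.
  - by rewrite mulr_ge0// ltW.
  - exact: sqr_ge0.
  - apply: le_trans (ler_bernoulli _ (ltW eta0)).
    apply: (@le_trans _ _ (((size f).-1 ^ n)%:R * eta)); last by rewrite lerDr.
    by rewrite ler_wpM2r ?(ltW eta0)// ler_nat ltnW.
  - by rewrite ler_pXn2r ?nnegrE ?normc_ge0// divr_ge0// subr_ge0 ltW.
have k0 : 0 < eta * ((b - a) / 2) ^+ 2.
  by rewrite mulr_gt0// exprn_gt0// divr_gt0// subr_gt0.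
have := main (Num.truncn (C ^+ 2 / (eta * ((b - a) / 2) ^+ 2))).+1.
by rewrite -mulrA leNgt -ltr_pdivrMr// truncnS_gt.
Qed.

End real_polynomial_dynamics.

Lemma seq_extrema (R : realType) (s : seq R) : s != [::] ->
  (exists2 m, m \in s & forall x, x \in s -> x <= m) /\
  (exists2 m, m \in s & forall x, x \in s -> m <= x).
Proof.
elim: s => // a [|b s] IH _.
  by split; exists a; rewrite ?mem_head// => x; rewrite inE => /eqP ->.
have [//|[M Ms HM] [m ms Hm]] := IH; split.
  exists (Num.max a M).
    by rewrite maxElt; case: ifP; rewrite ?mem_head// in_cons Ms orbT.
  by move=> x; rewrite in_cons le_max => /orP[/eqP ->|/HM ->]; rewrite ?lexx ?orbT.
exists (Num.min a m).
  by rewrite minElt; case: ifP; rewrite ?mem_head// in_cons ms orbT.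
by move=> x; rewrite in_cons ge_min => /orP[/eqP ->|/Hm ->]; rewrite ?lexx ?orbT.
Qed.

Lemma poly_extremal_roots (R : realType) (p : {poly R}) x0 : p != 0 -> root p x0 ->
  (exists2 m, root p m & forall x, root p x -> x <= m) /\
  (exists2 m, root p m & forall x, root p x -> m <= x).
Proof.
move=> p0 px0.
have rE x : root p x = (x \in rootsR p).
  by have := roots_on_rootsR p0 x; rewrite in_itv/= => <-.
have : rootsR p != [::].
  by apply: contraTneq px0; rewrite rE => ->.
move=> /seq_extrema[[M Ms HM] [m ms Hm]]; split.
  by exists M => [|x]; rewrite rE//; exact: HM.
by exists m => [|x]; rewrite rE//; exact: Hm.
Qed.

(** On the vertical ray from z away from the real axis, take the supremum of the parameters with
    bounded orbit. The orbit there can be neither bounded nor unbounded, since both conditions are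
    open on the ray. *)
Lemma real_fatou_bounded_orbit_real (R : realType) (p : {poly R[i]}) :
  (2 < size p)%N ->
  (forall z, Im z != 0 -> fatou_set (poly_map p) (Some z)) ->
  forall z, bounded_orbit p z -> Im z = 0.
Proof.
move=> sp HF z bz; apply/eqP; apply: contraT => Imz.
have [M M0 HM] := poly_normc_double sp.
(* For s >= 0 the factor 1 + s leads away from the real axis whatever the sign of [Im z], so [w s]
   stays in the Fatou set. *)
pose w s : R[i] := (Re z +i* ((1 + s) * Im z))%C.
have wB s s' : normc (w s - w s') = `|s - s'| * `|Im z|.
  by rewrite /w /= subrr expr0n/= add0r sqrtr_sqr -normrM; congr `|_|; ring.
have Imw s : 0 <= s -> Im (w s) != 0.
  by move=> s0; rewrite mulf_neq0// gt_eqF// ltr_pwDl.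
have y0 : 0 < `|Im z| by rewrite normr_gt0.
pose T := [set s : R | 0 <= s /\ bounded_orbit p (w s)].
have T0 : T 0 by split=> //; rewrite /w addr0 mul1r; case: (z) bz.
have Tub : ubound T (M / `|Im z|).
  move=> s [s0 /(bounded_orbit_le M0 HM 0) /= wM].
  rewrite ler_pdivlMr//; apply: le_trans wM.
  apply: (@le_trans _ _ `|(1 + s) * Im z|).
    by rewrite normrM ler_wpM2r// ger0_norm; lra.
  by rewrite -sqrtr_sqr ler_wsqrtr// lerDr sqr_ge0.
have Tsup : has_sup T by split; [exists 0|exists (M / `|Im z|)].
have S0 : 0 <= sup T by apply: ub_le_sup => //; exists (M / `|Im z|).
have [bS|uS] := pselect (bounded_orbit p (w (sup T))).
  have [d d0 Hd] := bounded_orbit_near M0 HM (HF _ (Imw _ S0)) bS.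
  pose e := d / (2 * `|Im z|).
  have e0 : 0 < e by rewrite divr_gt0// mulr_gt0.
  have /(ub_le_sup (proj2 Tsup)) : T (sup T + e).
    split; first by rewrite addr_ge0// ltW.
    apply: Hd; rewrite wB addrAC subrr add0r gtr0_norm//.
    have -> : e * `|Im z| = d / 2 by rewrite /e; field; rewrite gt_eqF.
    by rewrite ltr_pdivrMr//; lra.
  by rewrite leNgt ltrDl e0.
have [d d0 Hd] := unbounded_orbit_near sp M0 HM uS.
have e0 : 0 < d / `|Im z| by rewrite divr_gt0.
have [s Ts sS] := sup_adherent e0 Tsup.
have sle : s <= sup T by apply: ub_le_sup Ts; exact: (proj2 Tsup).
case: Ts => _ bs; suff /Hd : normc (w s - w (sup T)) < d by [].
rewrite wB distrC ger0_norm ?subr_ge0//.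
by rewrite -ltr_pdivlMr//; lra.
Qed.

(** * Even degree and positive leading coefficient *)

Section even_polynomial.
Context {R : realType} (f : {poly R}).
Hypothesis deg_ge2 : (2 <= (size f).-1)%N.
Hypothesis deg_even : ~~ odd (size f).-1.
Hypothesis lead_gt0 : 0 < lead_coef f.

Let size_gt2 : (2 < size f)%N.
Proof. by case: (size f) deg_ge2. Qed.

Let size_subC c : size (f - c%:P) = size f.
Proof.
by rewrite size_polyDl// size_polyN (leq_ltn_trans (size_polyC_leq1 c))// ltnW.
Qed.

Let size_subX : size (f - 'X) = size f.
Proof. by rewrite size_polyDl// size_polyN size_polyX. Qed.

Let subC_neq0 c : f - c%:P != 0.
Proof. by rewrite -size_poly_gt0 size_subC ltnW// ltnW. Qed.

Let rootC_E c x : root (f - c%:P) x = (f.[x] == c).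
Proof. by rewrite /root hornerD hornerN hornerC subr_eq0. Qed.

Let rootX_E x : root (f - 'X) x = (f.[x] == x).
Proof. by rewrite /root hornerD hornerN hornerX subr_eq0. Qed.

Let critical_intervalE t : critical_interval f t <-> real_rooted (f - t%:P).
Proof. by rewrite -(sum_mup_rootsR (subC_neq0 t)) size_subC. Qed.

(** f - X has no root beyond a, so it keeps there the sign of its leading coefficient, which is that
    of f. *)
Let above_right a : (forall x, f.[x] = x -> x <= a) -> forall x, a < x -> x < f.[x].
Proof.
move=> Ha x ax.
have nr : {in `[x, +oo[, forall y, ~~ root (f - 'X) y}.
  move=> y; rewrite in_itv/= andbT => xy; rewrite rootX_E; apply/eqP => /Ha.
  by rewrite leNgt (lt_le_trans ax xy).
have /(sgp_pinftyP nr) : x \in `[x, +oo[ by rewrite in_itv/= lexx.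
rewrite /sgp_pinfty.
rewrite lead_coefDl ?size_polyN ?size_polyX// (gtr0_sg lead_gt0) => /eqP.
by rewrite sgr_cp0 hornerD hornerN hornerX subr_gt0.
Qed.

(** f - c has no root to the left of a, and even degree makes its sign at minus infinity
    positive. *)
Let above_left a c : (forall x, f.[x] = c -> a <= x) -> forall x, x < a -> c < f.[x].
Proof.
move=> Ha x xa.
have nr : {in `]-oo, x], forall y, ~~ root (f - c%:P) y}.
  move=> y; rewrite in_itv/= => yx; rewrite rootC_E; apply/eqP => /Ha.
  by rewrite leNgt (le_lt_trans yx xa).
have /(sgp_minftyP nr) : x \in `]-oo, x] by rewrite in_itv/= lexx.
rewrite /sgp_minfty size_subC.
rewrite lead_coefDl ?size_polyN ?(leq_ltn_trans (size_polyC_leq1 c)) 1?ltnW//.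
rewrite -signr_odd (negPf deg_even) expr0 mul1r (gtr0_sg lead_gt0) => /eqP.
by rewrite sgr_cp0 hornerD hornerN hornerC subr_gt0.
Qed.

(** Rules out a degenerate interval, as [nonreal_unbounded_orbit] separates two distinct
    endpoints. *)
Let endpoints_lt a1 a2 : f.[a2] = a2 -> (forall x, f.[x] = x -> x <= a2) ->
  (forall x, f.[x] = a2 -> a1 <= x) -> a1 < a2.
Proof.
move=> f2 H2 H1; rewrite lt_neqAle H1// andbT; apply/eqP => a12.
have [q qE] : exists q, f - a2%:P = q * ('X - a2%:P).
  by apply/factor_theorem; rewrite rootC_E f2.
have qx x : q.[x] * (x - a2) = f.[x] - a2.
  have /(congr1 (horner^~ x)) := qE.
  by rewrite hornerM hornerXsubC hornerD hornerN hornerC.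
have qr x : a2 < x -> 1 < q.[x].
  move=> x2; have := above_right H2 x2; rewrite -(ltrD2r (- a2)) -qx.
  by rewrite -{1}[x - a2]mul1r ltr_pM2r// subr_gt0.
have ql x : x < a2 -> q.[x] < 0.
  rewrite -{1}a12 => x1; have := above_left H1 x1; rewrite -subr_gt0 -qx.
  by rewrite nmulr_lgt0// subr_lt0 -a12.
(* f - a2 = q (X - a2) with q < 0 on the left of a2 and q > 1 on its right, so
   q takes each value in ]0, 1[ at a2 only. *)
have mid c : 0 < c < 1 -> q.[a2] = c.
  move=> /andP[c0 c1].
  have [||x _] := @poly_ivt _ (q - c%:P) (a2 - 1) (a2 + 1); first lra.
    rewrite !hornerD !hornerN !hornerC.
    have := @ql (a2 - 1); have := @qr (a2 + 1).
    rewrite ltrDl gtrDl ltrN10 ltr01 => /(_ isT) ? /(_ isT) ?.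
    by apply/andP; split; lra.
  rewrite /root hornerD hornerN hornerC subr_eq0 => /eqP qc.
  have [x2|x2|<-//] := ltgtP x a2.
    by have := ql _ x2; lra.
  by have := qr _ x2; lra.
have := mid 2^-1; have := mid (3%:R / 4%:R); lra.
Qed.

(** Supplies the backward invariance of [a1, a2]: the critical interval makes preimages real, and f
    exceeds a2 on both sides of [a1, a2]. *)
Let preimage_interval a1 a2 :
  (forall x, f.[x] = x -> x <= a2) -> (forall x, f.[x] = a2 -> a1 <= x) ->
  `[a1, a2] `<=` critical_interval f ->
  forall t w, a1 <= t <= a2 -> (cx f).[w] = t%:C%C ->
    exists2 x, a1 <= x <= a2 & w = x%:C%C.
Proof.
move=> H2 H1 HI t w /andP[t1 t2] fw.
have := HI t; rewrite /= in_itv/= t1 t2 => /(_ isT)/critical_intervalE/(_ w).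
rewrite rmorphB/= map_polyC/= /root hornerD hornerN hornerC fw subrr.
move=> /(_ (eqxx _))/Im0_real wE; exists (Re w) => //.
move: fw; rewrite wE horner_cx => -[fw]; apply/andP; split; rewrite leNgt; apply/negP.
  by move=> /(above_left H1); rewrite fw; lra.
by move=> xa; have := above_right H2 xa; rewrite fw; lra.
Qed.

Lemma julia_real_of_critical a1 a2 : f.[a2] = a2 ->
  (forall x, f.[x] = x -> x <= a2) -> (forall x, f.[x] = a2 -> a1 <= x) ->
  `[a1, a2] `<=` critical_interval f -> poly_julia_set f `<=` real_points R.
Proof.
move=> f2 H2 H1 HI.
have sp : (2 < size (cx f))%N by rewrite size_map_poly.
have [M M0 HM] := poly_normc_double sp.
case=> [z|] nF; last by case: (nF (infty_fatou sp M0 HM)).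
have [/Im0_real ->|Imz] := eqVneq (Im z) 0; first by exists (Re z).
case: nF; apply: (unbounded_orbit_fatou sp M0 HM).
apply: (nonreal_unbounded_orbit size_gt2 (endpoints_lt f2 H2 H1) _ Imz).
exact: preimage_interval.
Qed.

Lemma critical_of_julia_real : poly_julia_set f `<=` real_points R ->
  exists a1 a2 : R,
    [/\ f.[a2] = a2 /\ (forall x, f.[x] = x -> x <= a2),
        f.[a1] = a2 /\ (forall x, f.[x] = a2 -> a1 <= x)
      & `[a1, a2] `<=` critical_interval f].
Proof.
move=> HJ.
have sp : (2 < size (cx f))%N by rewrite size_map_poly.
have breal : forall z, bounded_orbit (cx f) z -> Im z = 0.
  apply: real_fatou_bounded_orbit_real => // z Imz; apply: contrapT => /HJ[t _ [tz]].
  by move: Imz; rewrite -tz eqxx.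
(* A complex fixed point exists by degree; its orbit is bounded, so it is real. *)
have [z0] : exists z, root (cx f - 'X) z.
  apply/closed_rootP; rewrite size_polyDl ?size_polyN ?size_polyX//.
  by case: (size _) sp => [|[]].
rewrite /root hornerD hornerN hornerX subr_eq0 => /eqP fz0.
have z0E := Im0_real (breal _ (bounded_orbit_fixed fz0)).
have rx0 : root (f - 'X) (Re z0).
  by move: fz0; rewrite rootX_E {1 2}z0E horner_cx => -[->].
have fX0 : f - 'X != 0 by rewrite -size_poly_gt0 size_subX ltnW// ltnW.
have [[a2] + H2 _] := poly_extremal_roots fX0 rx0.
rewrite rootX_E => /eqP f2.
have ra2 : root (f - a2%:P) a2 by rewrite rootC_E f2.
have [_ [a1 + H1]] := poly_extremal_roots (subC_neq0 a2) ra2.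
rewrite rootC_E => /eqP f1.
have b2 : bounded_orbit (cx f) a2%:C%C.
  by apply: bounded_orbit_fixed; rewrite horner_cx f2.
have b1 : bounded_orbit (cx f) a1%:C%C.
  by apply: bounded_orbit_preimage; rewrite horner_cx f1.
(* Preimages of a point with bounded orbit have bounded orbits, hence are real. *)
have brr c : bounded_orbit (cx f) c%:C%C -> real_rooted (f - c%:P).
  move=> bc z; rewrite rmorphB/= map_polyC/= /root hornerD hornerN hornerC.
  rewrite subr_eq0 => /eqP fz; apply/breal/bounded_orbit_preimage.
  by rewrite fz.
exists a1, a2; split.
- by split=> // x fx; apply: H2; rewrite rootX_E fx.
- by split=> // x fx; apply: H1; rewrite rootC_E fx.
move=> t; rewrite /= in_itv/= => t12; apply/critical_intervalE.
exact: (real_rooted_convex size_gt2 t12 (brr _ b1) (brr _ b2)).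
Qed.

End even_polynomial.

Theorem proposition1p3 (R : realType) (f : {poly R})
    (deg_ge2 : (2 <= (size f).-1)%N) (deg_even : ~~ odd (size f).-1)
    (lead_gt0 : 0 < lead_coef f) :
  poly_julia_set f `<=` real_points R <->
  (exists x : R, f.[x] = x) /\
  (exists a1 a2 : R,
    [/\ f.[a2] = a2 /\ (forall x, f.[x] = x -> x <= a2),
        f.[a1] = a2 /\ (forall x, f.[x] = a2 -> a1 <= x)
      & `[a1, a2] `<=` critical_interval f]).
Proof.
split=> [HJ|[_ [a1 [a2 [[f2 H2] [_ H1] HI]]]]].
  have [a1 [a2 [[f2 H2] H1 HI]]] := critical_of_julia_real deg_ge2 HJ.
  by split; [exists a2|exists a1, a2].
exact: julia_real_of_critical HI.
Qed.
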